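(* Let $k\ge 2$ be an integer, let $m\ge 6$ be an even integer, and let $G$ be either $\widehat{K}_m$ or $W_m$. Then $$GR_k(G)\ \ge\ \begin{cases} \max\{2R_2(G)-1,\ 5m+1\}, & \text{if } k=3;\\ R_2(G)+5(m-2)\bigl(5^{\frac{k-2}{2}}-1\bigr)-(m-4)(k-2), & \text{if } k \text{ is even and } m\equiv 0 \pmod 4;\\ R_2(G)+5(m-1)\bigl(5^{\frac{k-2}{2}}-1\bigr)-(m-2)(k-2), & \text{if } k \text{ is even and } m\equiv 2 \pmod 4;\\ 2\bigl(R_2(G)+5(m-2)(5^{\frac{k-3}{2}}-1)-(m-4)(k-3)\bigr)-1, & \text{if } k\ge 5 \text{ is odd and } m\equiv 0 \pmod 4;\\ 2\bigl(R_2(G)+5(m-1)(5^{\frac{k-3}{2}}-1)-(m-2)(k-3)\bigr)-1, & \text{if } k\ge 5 \text{ is odd and } m\equiv 2 \pmod 4. \end{cases}$$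
   Context: Graphs are finite and simple. $K_1+G$ denotes the graph obtained from $G$ by adding one new vertex (the central vertex) adjacent to every vertex of $G$. The kipas is $\widehat{K}_m=K_1+P_m$, where $P_m$ is the path on $m$ vertices, and the wheel is $W_m=K_1+C_m$, where $C_m$ is the cycle on $m$ vertices. $R_2(G)=R(G,G)$ is the 2-color Ramsey number: the smallest positive integer $N$ such that every coloring of the edges of $K_N$ with two colors contains a monochromatic subgraph isomorphic to $G$. A Gallai coloring is an edge coloring that contains no rainbow triangle, i.e. no triangle whose three edges have three pairwise different colors. For a graph $G$ and a positive integer $k$, the Gallai-Ramsey number $GR_k(G)$ is the smallest positive integer $N$ such that every Gallai coloring $\tau:E(K_N)\to\{1,\dots,k\}$ (not all colors need be used) contains a monochromatic subgraph isomorphic to $G$. *)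

(* Defs.v *)
From mathcomp Require Import all_boot.

Set Implicit Arguments.
Unset Strict Implicit.
Unset Printing Implicit Defensive.

Record sgraph := SGraph {
  vertex :> finType;
  adj : rel vertex;
  adj_sym : symmetric adj;
  adj_irr : irreflexive adj
}.

Section Cone.
Variable G : sgraph.

(* K_1 + G: the central vertex is None. *)
Definition cone_adj : rel (option G) := fun u v =>
  match u, v with
  | Some x, Some y => adj x y
  | None, None => false
  | _, _ => true
  end.

Lemma cone_adj_sym : symmetric cone_adj.
Proof. by move=> [x|] [y|] //=; rewrite adj_sym. Qed.

Lemma cone_adj_irr : irreflexive cone_adj.
Proof. by move=> [x|] //=; rewrite adj_irr. Qed.

Definition cone : sgraph := SGraph cone_adj_sym cone_adj_irr.
End Cone.

Section PathCycle.
Variable m : nat.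

Definition path_adj : rel 'I_m := fun i j => (i.+1 == j) || (j.+1 == i).

Lemma path_adj_sym : symmetric path_adj.
Proof. by move=> i j; rewrite /path_adj orbC. Qed.

Lemma path_adj_irr : irreflexive path_adj.
Proof. by move=> i; rewrite /path_adj orbb gtn_eqF. Qed.

Definition path_graph : sgraph := SGraph path_adj_sym path_adj_irr.

(* ordS is the cyclic successor i |-> i + 1 mod m; the condition i != j
   only matters for m = 1. *)
Definition cycle_adj : rel 'I_m := fun i j =>
  (i != j) && ((ordS i == j) || (ordS j == i)).

Lemma cycle_adj_sym : symmetric cycle_adj.
Proof. by move=> i j; rewrite /cycle_adj eq_sym orbC. Qed.

Lemma cycle_adj_irr : irreflexive cycle_adj.
Proof. by move=> i; rewrite /cycle_adj eqxx. Qed.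

Definition cycle_graph : sgraph := SGraph cycle_adj_sym cycle_adj_irr.
End PathCycle.

Definition kipas (m : nat) : sgraph := cone (path_graph m).
Definition wheel (m : nat) : sgraph := cone (cycle_graph m).

(* A k-coloring of the edges of the complete graph on the finite type V.  The
   edges are the two-element sets [set x; y] with x != y; the values on other
   sets are junk that no definition below inspects. *)
Definition coloring (k : nat) (V : finType) := {ffun {set V} -> 'I_k}.

Section Colorings.
Variables (k : nat) (V : finType) (tau : coloring k V).

Definition rainbow_triangle (x y z : V) : bool :=
  uniq [:: x; y; z] &&
  uniq [:: tau [set x; y]; tau [set y; z]; tau [set x; z]].

Definition gallai : bool :=
  [forall x, forall y, forall z, ~~ rainbow_triangle x y z].

(* f embeds G as a (not necessarily induced) subgraph of the complete graph. *)
Definition has_mono (G : sgraph) : bool :=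
  [exists i : 'I_k, exists f : {ffun G -> V},
    injectiveb f &&
    [forall x, forall y, adj x y ==> (tau [set f x; f y] == i)]].
End Colorings.

Definition ramsey_forces (k : nat) (G : sgraph) (N : nat) : bool :=
  (0 < N) && [forall tau : coloring k 'I_N, has_mono tau G].

Definition gallai_ramsey_forces (k : nat) (G : sgraph) (N : nat) : bool :=
  (0 < N) && [forall tau : coloring k 'I_N, gallai tau ==> has_mono tau G].

(* Ramsey's theorem, so that the minima defining R_2 and GR_k exist. *)
Lemma ramsey_clique (k : nat) (a : {ffun 'I_k -> nat}) :
  exists N : nat, forall (V : finType) (tau : coloring k V) (A : {set V}),
    N <= #|A| -> exists i : 'I_k, exists S : {set V},
      [/\ S \subset A, a i <= #|S| &
          {in S &, forall x y, x != y -> tau [set x; y] = i}].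
Proof.
have [n] := ubnP (\sum_i a i); elim: n a => // n IHn a lt_a.
have [/existsP[i /eqP ai0]|] := boolP [exists i, a i == 0].
  exists 0 => V tau A _; exists i, set0; rewrite ai0 sub0set; split=> // x y.
  by rewrite inE.
rewrite negb_exists => /forallP a_neq0.
pose b (i : 'I_k) := [ffun j => if j == i then (a j).-1 else a j].
have lt_b i : \sum_j b i j < n.
  move: lt_a; rewrite ltnS; apply: leq_trans.
  rewrite (bigD1 i) //= [X in _ < X](bigD1 i) //= ffunE eqxx.
  rewrite (eq_bigr a) => [|j /negbTE ne_ji]; last by rewrite ffunE ne_ji.
  by rewrite ltn_add2r prednK // lt0n.
have /fin_all_exists[N HN] i := IHn (b i) (lt_b i).
exists (\sum_i N i).+1 => V tau A leNA.
have [x Ax] : exists x, x \in A by apply/card_gt0P; apply: leq_trans leNA.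
pose B i := [set y in A :\ x | tau [set x; y] == i].
have cardB : \sum_i #|B i| = #|A :\ x|.
  rewrite -sum1_card (partition_big (fun y => tau [set x; y]) xpredT) //=.
  by apply: eq_bigr => i _; rewrite -sum1_card; apply: eq_bigl => y; rewrite !inE.
have [i leNB] : exists i, N i <= #|B i|.
  apply/existsP; apply: contraLR leNA; rewrite negb_exists => /forallP ltB.
  rewrite -leqNgt (cardsD1 x) Ax -cardB add1n.
  rewrite (bigD1 (tau set0)) //= [X in _ < X](bigD1 (tau set0)) //= -addSn.
  apply: leq_add; first by rewrite ltnNge.
  by apply: leq_sum => j _; apply: ltnW; rewrite ltnNge.
have [j [S [sSB bS cS]]] := HN i V tau (B i) leNB.
have sBA : B i \subset A by apply/subsetP=> y; rewrite !inE => /andP[/andP[]].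
move: bS; rewrite ffunE; have [eq_ji | _] := eqVneq j i; last first.
  by move=> aS; exists j, S; split=> //; apply: subset_trans sBA.
rewrite {j}eq_ji in cS * => aS; exists i, (x |: S).
have cx y : y \in S -> tau [set x; y] = i.
  by move/(subsetP sSB); rewrite !inE => /andP[_ /eqP].
split; first by rewrite subUset sub1set Ax (subset_trans sSB).
  rewrite cardsU1; have -> : x \notin S.
    by apply/negP=> /(subsetP sSB); rewrite !inE eqxx.
  by rewrite -(prednK (n := a i)) ?lt0n // add1n ltnS.
move=> y z /setU1P[->|Sy] /setU1P[->|Sz]; rewrite ?eqxx // => ne.
- exact: cx.
- by rewrite setUC; apply: cx.
- exact: cS.
Qed.

Lemma ramsey_ex (k : nat) (G : sgraph) : exists N, ramsey_forces k G N.
Proof.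
have [N HN] := ramsey_clique [ffun _ : 'I_k => #|G|].
exists N.+1; apply/andP; split=> //; apply/forallP=> tau.
have [|i [S [_ aS cS]]] := HN _ tau setT; first by rewrite cardsT card_ord.
rewrite ffunE in aS.
apply/existsP; exists i; apply/existsP.
pose r (x : G) : 'I_#|S| := widen_ord aS (enum_rank x).
have r_inj : injective r by move=> x y /(congr1 val) /= /ord_inj /enum_rank_inj.
exists [ffun x => enum_val (r x)]; apply/andP; split.
  by apply/injectiveP=> x y; rewrite !ffunE => /enum_val_inj /r_inj.
apply/forallP=> x; apply/forallP=> y; apply/implyP=> xy; rewrite !ffunE.
apply/eqP/cS; rewrite ?enum_valP // (inj_eq enum_val_inj) (inj_eq r_inj).
by apply: contraTneq xy => ->; rewrite adj_irr.
Qed.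

Lemma gallai_ramsey_ex (k : nat) (G : sgraph) :
  exists N, gallai_ramsey_forces k G N.
Proof.
have [N /andP[N0 /forallP H]] := ramsey_ex k G.
by exists N; rewrite /gallai_ramsey_forces N0; apply/forallP=> tau; rewrite H implybT.
Qed.

Definition R2 (G : sgraph) : nat := ex_minn (ramsey_ex 2 G).

Definition GR (k : nat) (G : sgraph) : nat := ex_minn (gallai_ramsey_ex k G).

(* Main.v *)
Require Import Defs.
From mathcomp Require Import all_boot all_order all_algebra.
From mathcomp Require Import zify.

Set Implicit Arguments.
Unset Strict Implicit.
Unset Printing Implicit Defensive.

Import Order.TTheory GRing.Theory Num.Theory.

(* The colourings come from substituting into the 2-coloured K_5 whose colour
   classes are two pentagons.  Let G = K_1 + H with H containing P_m, and call a
   colour sparse in a part if its degrees are at most m/2 - 1 and its paths have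
   fewer than m vertices.  If a is one of the pentagon colours, a may still occur
   sparsely inside two parts that are nonadjacent in the a-pentagon: for v in such
   a part, a path in the a-neighbourhood of v alternates between at most m/2 - 1
   vertices of that part and an a-independent set, so it has at most m - 1
   vertices; for the other v it stays within one part.  The two pentagon colours
   thus give four of the five parts one extra sparse colour each.

   Let F_j be a G-free colouring with 2j + 2 colours, starting from an extremal
   2-colouring F_0 on R_2(G) - 1 vertices.  F_j consists of F_(j-1) in one part and,
   in the other four, of nested pentagons in the 2j colours of F_(j-1) together
   with one extra sparse colour.  In such a part, the inner pentagons provide all
   5^j leaves but one with a second sparse colour; a leaf with two sparse colours
   can have s = m - 1 (if m = 2 mod 4) or s = m - 2 (if m = 0 mod 4) vertices, and
   a leaf with one sparse colour m/2 vertices.  Hence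
   |F_j| = |F_(j-1)| + 4 ((5^j - 1) s + m/2).
   For odd k, two copies are joined completely in the last colour. *)

(** * Colourings with natural-number colours, and sparse colours *)

Record cgraph := CGraph { cvertex :> finType; colour : cvertex -> cvertex -> nat }.

Definition edge (X : cgraph) (c : nat) : rel X :=
  fun x y => (x != y) && (colour x y == c).

Definition avoids (X : cgraph) (c : nat) : Prop := forall x y : X, ~~ edge c x y.

Definition cgallai (X : cgraph) : Prop :=
  forall x y z : X, uniq [:: x; y; z] ->
    ~~ uniq [:: colour x y; colour y z; colour x z].

Definition csym (X : cgraph) : Prop := forall x y : X, colour x y = colour y x.

Definition sparse (m : nat) (X : cgraph) (c : nat) : Prop :=
  (forall x : X, #|[set y | edge c x y]| <= m./2.-1) /\
  (forall q : seq X, uniq q -> sorted (edge c) q -> size q < m).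

Definition gfree (G : sgraph) (X : cgraph) (c : nat) : Prop :=
  forall f : G -> X, injective f ->
    ~ (forall x y, adj x y -> edge c (f x) (f y)).

Lemma avoids_sparse m X c : 1 < m -> avoids X c -> sparse m X c.
Proof.
move=> m1 av; split=> [x|[|x [|y q]] //=]; last 2 first.
- by move=> _ _; apply: ltnW.
- by rewrite (negbTE (av x y)).
rewrite (_ : [set y | _] = set0) ?cards0 //.
by apply/setP=> y; rewrite !inE (negbTE (av x y)).
Qed.

(** * Substituting colourings into the vertices of a pattern *)

Section Substitution.
Variables (I : finType) (c0 : I -> I -> nat) (X_ : I -> cgraph).

Definition subst_col (x y : {i : I & X_ i}) : nat :=
  if tag x == tag y then colour (tagged x) (tagged_as x y)
  else c0 (tag x) (tag y).

Definition subst : cgraph := CGraph subst_col.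

Lemma card_subst : #|subst| = \sum_i #|X_ i|.
Proof. by rewrite card_tagged sumnE big_map big_enum. Qed.

Lemma subst_colE i (u v : X_ i) :
  colour (Tagged X_ u : subst) (Tagged X_ v) = colour u v.
Proof. by rewrite /= /subst_col eqxx tagged_asE. Qed.

Lemma subst_col_neq (x y : subst) :
  tag x != tag y -> colour x y = c0 (tag x) (tag y).
Proof. by rewrite /= /subst_col => /negbTE->. Qed.

Lemma Tagged_inj i : injective (Tagged X_ : X_ i -> subst).
Proof. by move=> u v /eqP; rewrite eq_Tagged /= => /eqP. Qed.

Lemma edge_Tagged c i (u v : X_ i) :
  edge c (Tagged X_ u : subst) (Tagged X_ v) = edge c u v.
Proof. by rewrite /edge (inj_eq (@Tagged_inj i)) subst_colE. Qed.

Lemma subst_csym : (forall i j, c0 i j = c0 j i) ->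
  (forall i, csym (X_ i)) -> csym subst.
Proof.
move=> s0 sX [i u] [j v]; have [e|ne] := eqVneq i j.
  by case: j / e v => v; rewrite !subst_colE sX.
by rewrite !subst_col_neq //= 1?eq_sym // s0.
Qed.

(** A triangle meeting exactly two parts has two edges of the same pattern colour; any other
    triangle lies in one part or projects to a triangle of the pattern. *)
Lemma subst_gallai : (forall i j, c0 i j = c0 j i) ->
  (forall i j k, uniq [:: i; j; k] -> ~~ uniq [:: c0 i j; c0 j k; c0 i k]) ->
  (forall i, csym (X_ i)) -> (forall i, cgallai (X_ i)) -> cgallai subst.
Proof.
move=> s0 g0 sX gX [i u] [j v] [k w].
have [eij|nij] := eqVneq i j.
  case: j / eij v => v; have [eik|nik] := eqVneq i k.
    case: k / eik w => w uvw; rewrite !subst_colE; apply: gX.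
    by move: uvw; rewrite -(map_inj_uniq (@Tagged_inj i)).
  by move=> _; rewrite !(@subst_col_neq _ (Tagged X_ w)) //= !inE eqxx ?orbT ?andbF.
have [ejk|njk] := eqVneq j k.
  by case: k / ejk w => w _; rewrite !(@subst_col_neq (Tagged X_ u)) //= !inE eqxx ?orbT.
have [eik|nik] := eqVneq i k.
  case: k / eik w njk => w nji _.
  by rewrite (@subst_col_neq (Tagged X_ u)) // (@subst_col_neq (Tagged X_ v)) //= s0 !inE eqxx.
move=> _; rewrite !subst_col_neq //; apply: g0.
by rewrite /= !inE negb_or nij nik njk.
Qed.

Lemma in_part i (q : seq subst) : {in q, forall y, tag y = i} ->
  exists q' : seq (X_ i), q = [seq Tagged X_ u | u <- q'].
Proof.
elim: q => [|[j v] q IHq] tq; first by exists [::].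
have [|q' ->] := IHq; first by move=> y yq; apply: tq; rewrite inE yq orbT.
have /= e : tag (Tagged X_ v) = i by apply: tq; rewrite mem_head.
by case: i / e q' {IHq tq} => q'; exists (v :: q').
Qed.

Lemma path_in_part m c i (q : seq subst) : sparse m (X_ i) c ->
  {in q, forall y, tag y = i} -> uniq q -> sorted (edge c) q -> size q < m.
Proof.
move=> [_ sp] /in_part[q' ->]; rewrite (map_inj_uniq (@Tagged_inj i)) size_map.
rewrite sorted_map => uq sq; apply: sp => //; congr is_true: sq.
by apply: eq_sorted => u v /=; rewrite edge_Tagged.
Qed.

Lemma path_const (T R : eqType) (h : T -> R) (e : rel T) (q : seq T) x :
  (forall y z, y \in x :: q -> z \in x :: q -> e y z -> h y = h z) ->
  path e x q -> {in x :: q, forall y, h y = h x}.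
Proof.
elim: q x => [|y q IHq] x he /=; first by move=> _ z; rewrite inE => /eqP->.
case/andP=> exy pq; have hxy : h x = h y.
  by apply: he exy; rewrite !inE eqxx ?orbT.
move=> z; rewrite inE => /predU1P[-> //|zq]; rewrite hxy; apply: IHq zq => //.
by move=> u v uq vq; apply: he; rewrite inE ?uq ?vq orbT.
Qed.

Lemma deg_in_part m c (x : subst) : (forall i, sparse m (X_ i) c) ->
  #|[set y | edge c x y & tag y == tag x]| <= m./2.-1.
Proof.
case: x => i u /(_ i)[/(_ u) dg _]; apply: leq_trans dg.
rewrite -(card_imset _ (@Tagged_inj i)); apply/subset_leq_card/subsetP=> -[j v].
rewrite inE /= => /andP[euv /eqP e]; case: i / e u euv => u.
by rewrite edge_Tagged => euv; apply: imset_f; rewrite inE.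
Qed.

Section UnusedColour.
Variable c : nat.
Hypothesis c0c : forall i j, i != j -> c0 i j != c.

Lemma edge_tag (x y : subst) : edge c x y -> tag x = tag y.
Proof.
case/andP=> _; have [-> //|ne] := eqVneq (tag x) (tag y).
by rewrite (subst_col_neq ne) (negbTE (c0c ne)).
Qed.

Lemma subst_sparse m : 0 < m -> (forall i, sparse m (X_ i) c) -> sparse m subst c.
Proof.
move=> m0 sp; split=> [x|[|x q] // uq sq].
  apply: leq_trans (deg_in_part x sp); apply/subset_leq_card/subsetP=> y.
  by rewrite !inE => exy; rewrite exy (edge_tag exy) eqxx.
apply: (path_in_part (sp (tag x))) uq (sq).
apply: path_const sq => y z _ _; exact: edge_tag.
Qed.

(** The centre of a cone is joined to all other vertices, and edges of colour [c] stay inside parts,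
    so a copy in colour [c] would lie in the part of its centre. *)
Lemma subst_gfree (H : sgraph) :
  (forall i, gfree (cone H) (X_ i) c) -> gfree (cone H) subst c.
Proof.
move=> gf f f_inj fe; pose i := tag (f None).
have /fin_all_exists[f' ff'] (x : cone H) : exists u : X_ i, f x = Tagged X_ u.
  have : tag (f x) = i.
    by case: x => [x|] //; apply/esym/edge_tag/fe.
  by case: (f x) => j u /= e; case: i / e; exists u.
apply: (gf i f') => [x y exy|x y xy]; first by apply: f_inj; rewrite !ff' exy.
by rewrite -edge_Tagged -!ff' fe.
Qed.
End UnusedColour.
End Substitution.

(** * Cones in a colour used by the pattern *)

Definition has_path (m : nat) (H : sgraph) : Prop :=
  exists q : seq H, [/\ uniq q, size q = m & sorted (@adj H) q].

(** No two consecutive terms both fail [a], so at most one more term fails [a] than satisfies it. *)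
Lemma size_count_sorted (T : Type) (a : pred T) (q : seq T) :
  sorted [rel x y | a x || a y] q -> size q <= (count a q).*2.+1.
Proof.
have [n] := ubnP (size q).
elim: n q => // n IHn [|x [|y q]] //= lt_n /andP[axy pq].
have [ax|nax] := boolP (a x).
  by have := IHn (y :: q) lt_n pq; rewrite /= !doubleD; lia.
move: axy; rewrite (negbTE nax) /= => ay.
by have := IHn q (ltnW lt_n) (path_sorted pq); rewrite ay !doubleD; lia.
Qed.

Lemma edge_not_avoids (I : finType) (c0 : I -> I -> nat) (X_ : I -> cgraph)
    (c : nat) (y z : subst c0 X_) :
  tag y = tag z -> edge c y z -> ~ avoids (X_ (tag y)) c.
Proof.
case: y z => i u [j v] /= e; case: j / e v => v.
by rewrite edge_Tagged => euv /(_ u v)/negP.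
Qed.

Section UsedColour.
Variables (I : finType) (c0 : I -> I -> nat) (X_ : I -> cgraph) (c m : nat).
Hypotheses (m_gt0 : 0 < m) (m_even : ~~ odd m).
Hypothesis tri_free : forall i j k, uniq [:: i; j; k] ->
  ~ (c0 i j = c /\ c0 i k = c /\ c0 j k = c).
Hypothesis sparse_c : forall i, sparse m (X_ i) c.
Hypothesis avoids_c : forall i j, i != j -> c0 i j = c ->
  avoids (X_ i) c \/ avoids (X_ j) c.

Lemma subst_gfree_used (H : sgraph) :
  has_path m H -> gfree (cone H) (subst c0 X_) c.
Proof.
move=> [p [up sp adjp]] f f_inj fe.
pose x := f None; pose q := [seq f (Some u) | u <- p].
have uq : uniq q by rewrite map_inj_uniq // => u v /f_inj[].
have sq : size q = m by rewrite size_map.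
have xq : {in q, forall y, edge c x y} by move=> y /mapP[u _ ->]; apply: fe.
have edgeq : sorted (edge c) q.
  rewrite sorted_map; apply: sub_sorted adjp => u v; exact: fe (Some u) (Some v).
have c0_out (y z : subst c0 X_) : tag y != tag z -> edge c y z ->
  c0 (tag y) (tag z) = c.
  by move=> nyz /andP[_ /eqP]; rewrite (subst_col_neq nyz).
(* Otherwise the parts of [x], [y] and [z] would form a triangle of colour [c] in the pattern. *)
have same_out y z : y \in q -> z \in q -> tag y != tag x -> tag z != tag x ->
    edge c y z -> tag y = tag z.
  move=> yq zq nyx nzx eyz; apply/eqP/negPn/negP=> nyz.
  apply: (@tri_free (tag x) (tag y) (tag z)).
    by rewrite /= !inE negb_or eq_sym nyx eq_sym nzx nyz.
  by split; [|split]; apply: c0_out; rewrite // 1?eq_sym // xq.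
have [/hasP[w wq /eqP wx]|] := boolP (has (fun y => tag y == tag x) q); last first.
  (* If the path misses the centre's part, it stays in a single part, where paths of colour [c] have
     fewer than [m] vertices. *)
  move=> /hasPn qx; case Eq: q => [|y q'].
    by move: sq m_gt0; rewrite Eq => <-.
  suff: size q < m by rewrite sq ltnn.
  apply: (path_in_part (sparse_c (tag y))) uq (edgeq).
  have pq : path (edge c) y q' by move: edgeq; rewrite Eq.
  rewrite Eq; apply: path_const pq.
  by rewrite -Eq => u v uq' vq; apply: same_out => //; apply: qx.
(* The edge from [x] to [w] lies in the centre's part, so parts joined to it in colour [c] have no
   edge of that colour. Hence of any two consecutive path vertices, one is in the centre's part. *)
have notavx : ~ avoids (X_ (tag x)) c.
  exact: edge_not_avoids (esym wx) (xq w wq).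
have esq : sorted [rel y z | (tag y == tag x) || (tag z == tag x)] q.
  apply: (@sub_in_sorted _ (mem q) _ _ _ q _ edgeq); last exact/allP.
  move=> y z yq zq eyz /=; apply/negPn/negP; rewrite negb_or => /andP[nyx nzx].
  have tyz := same_out y z yq zq nyx nzx eyz.
  have : c0 (tag x) (tag y) = c by apply: c0_out (xq _ yq); rewrite eq_sym.
  case/avoids_c => //; first by rewrite eq_sym.
  exact: edge_not_avoids tyz eyz.
(* The path vertices in the centre's part are neighbours of [x] there, hence at most m/2 - 1; the
   path then has at most 2(m/2 - 1) + 1 = m - 1 vertices. *)
have := size_count_sorted esq; rewrite sq -size_filter.
suff : size [seq y <- q | tag y == tag x] <= m./2.-1.
  by move: m_gt0 m_even; clear; lia.
apply: leq_trans (deg_in_part x sparse_c).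
rewrite -(card_uniqP (filter_uniq _ uq)); apply/subset_leq_card/subsetP=> y.
by rewrite mem_filter inE => /andP[-> /xq->].
Qed.
End UsedColour.

(** * The pentagon pattern and its iteration *)

Definition pentagon (a b : nat) (i j : 'I_5) : nat :=
  if (i.+1 == j %[mod 5]) || (j.+1 == i %[mod 5]) then a else b.

Lemma pentagon_sym a b i j : pentagon a b i j = pentagon a b j i.
Proof. by rewrite /pentagon orbC. Qed.

Lemma pentagon_in a b i j : pentagon a b i j = a \/ pentagon a b i j = b.
Proof. by rewrite /pentagon; case: ifP; [left | right]. Qed.

Lemma pentagon_tri_free a b c i j k : a != b -> uniq [:: i; j; k] ->
  ~ (pentagon a b i j = c /\ pentagon a b i k = c /\ pentagon a b j k = c).
Proof.
move=> /eqP nab.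
case: i => [[|[|[|[|[|//]]]]] ?]; case: j => [[|[|[|[|[|//]]]]] ?] //;
  case: k => [[|[|[|[|[|//]]]]] ?] //; rewrite /pentagon /= => _ [? [? ?]]; congruence.
Qed.

Section Colourings.
Variables (m : nat) (H : sgraph).
Hypotheses (m_gt1 : 1 < m) (m_even : ~~ odd m) (pathH : has_path m H).

(** Colours in [S] are kept sparse, so that an enclosing pattern may use them; in [U] only copies of
    the cone are excluded. *)
Record coloured (S U : seq nat) (X : cgraph) : Prop := Coloured {
  coloured_sym : csym X;
  coloured_gallai : cgallai X;
  coloured_colour : forall x y : X, x != y -> colour x y \in S ++ U;
  coloured_sparse : {in S, forall c, sparse m X c};
  coloured_free : {in U, forall c, gfree (cone H) X c} }.

Definition colourable (S U : seq nat) (n : nat) : Prop :=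
  exists X : cgraph, #|X| = n /\ coloured S U X.

Lemma coloured_avoids S U X c : coloured S U X -> c \notin S ++ U -> avoids X c.
Proof.
move=> cX cSU x y; apply: contra cSU => /andP[nxy /eqP<-].
exact: coloured_colour cX _ _ nxy.
Qed.

Lemma coloured_extra S U X a :
  a \notin S ++ U -> coloured S U X -> coloured (a :: S) U X.
Proof.
move=> aSU cX; split; try by case: cX.
  by move=> x y nxy; rewrite inE (coloured_colour cX nxy) orbT.
move=> c; rewrite inE => /predU1P[->|]; last exact: coloured_sparse cX c.
exact: avoids_sparse (coloured_avoids cX aSU).
Qed.

Lemma colourable_extra S U n a :
  a \notin S ++ U -> colourable S U n -> colourable (a :: S) U n.
Proof. by move=> aSU [X [<- cX]]; exists X; split=> //; exact: coloured_extra. Qed.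

(* The parts where a becomes sparse, 0 and 2, are nonadjacent in the pentagon of
   colour a; likewise 3 and 4 for b. *)
Lemma colourable_pentagon S U a b nA nB nW :
  uniq [:: a, b & S ++ U] ->
  colourable (a :: S) U nA -> colourable (b :: S) U nB -> colourable S U nW ->
  colourable S [:: a, b & U] (nA.*2 + nB.*2 + nW).
Proof.
rewrite /= inE negb_or => /and3P[/andP[nab aSU] bSU _].
move=> [A [<- cA]] [B [<- cB]] [W [<- cW]].
pose X_ (i : 'I_5) := nth W [:: A; W; A; B; B] i.
(* [T_ i] lists the pentagon colour, if any, that may occur sparsely inside part [i]. *)
pose T_ (i : 'I_5) := nth [::] [:: [:: a]; [::]; [:: a]; [:: b]; [:: b]] i.
have cX i : coloured (T_ i ++ S) U (X_ i).
  by case: i => [[|[|[|[|[|//]]]]] ?].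
have T_ab i : {subset T_ i <= [:: a; b]}.
  by case: i => [[|[|[|[|[|//]]]]] ?] c; rewrite !inE // => ->; rewrite ?orbT.
have spT i c : c \in [:: a; b] -> sparse m (X_ i) c.
  move=> cab; have [cT|cT] := boolP (c \in T_ i).
    by apply: (coloured_sparse (cX i)); rewrite mem_cat cT.
  apply: avoids_sparse => //; apply: (coloured_avoids (cX i)).
  rewrite -catA mem_cat (negbTE cT) /=.
  by move: cab; rewrite !inE => /orP[]/eqP->.
have c0_out c i j : c \in S ++ U -> pentagon a b i j != c.
  move=> cSU; apply/eqP=> e; case: (pentagon_in a b i j); rewrite e => ce.
    by rewrite -ce cSU in aSU.
  by rewrite -ce cSU in bSU.
have X_avoids c i j : c \in [:: a; b] -> i != j -> pentagon a b i j = c ->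
    avoids (X_ i) c \/ avoids (X_ j) c.
  move=> cab nij eij.
  have cSU : c \notin S ++ U by move: cab; rewrite !inE => /orP[]/eqP->.
  (* A finite check: two parts offered the same extra colour are joined by the other one. *)
  suff: (c \notin T_ i) || (c \notin T_ j).
    by case/orP=> cT; [left|right]; apply: (coloured_avoids (cX _));
       rewrite -catA mem_cat negb_or cT cSU.
  have /negbTE nba : b != a by rewrite eq_sym.
  move: cab nij eij; rewrite !inE => /orP[]/eqP-> /=;
  case: i => [[|[|[|[|[|//]]]]] ?]; case: j => [[|[|[|[|[|//]]]]] ?] //;
    rewrite /pentagon /= ?inE ?eqxx ?nba ?(negbTE nab) //= => _ /eqP;
    by rewrite ?nba ?(negbTE nab).
exists (subst (pentagon a b) X_); split.
  rewrite card_subst !big_ord_recl big_ord0 /= /X_ /=.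
  by rewrite -!addnn; lia.
split.
- by apply: subst_csym (@pentagon_sym a b) _ => i; case: (cX i).
- apply: subst_gallai (@pentagon_sym a b) _ _ _ => [i j k _|i|i]; try by case: (cX i).
  by case: (pentagon_in a b i j) => ->; case: (pentagon_in a b j k) => ->;
     case: (pentagon_in a b i k) => ->; rewrite /= !inE !eqxx ?orbT ?andbF.
- move=> [i u] [j v]; have [e|nij] := eqVneq i j.
    case: j / e v => v nuv; rewrite subst_colE.
    have := coloured_colour (cX i) (x := u) (y := v); rewrite -catA !mem_cat !inE.
    rewrite -(inj_eq (@Tagged_inj _ (pentagon a b) X_ i)) => /(_ nuv).
    by case/or3P=> [/T_ab|->|->]; rewrite ?inE ?orbT // => /orP[] ->; rewrite ?orbT.
  move=> _; rewrite subst_col_neq //= mem_cat !inE.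
  by case: (pentagon_in a b i j) => ->; rewrite eqxx ?orbT.
- move=> c cS; apply: subst_sparse; first by move=> i j _; rewrite c0_out // mem_cat cS.
    exact: ltnW.
  by move=> i; apply: (coloured_sparse (cX i)); rewrite mem_cat cS orbT.
- have used c : c \in [:: a; b] -> gfree (cone H) (subst (pentagon a b) X_) c.
    move=> cab; apply: subst_gfree_used pathH => //; first exact: ltnW.
    - by move=> i j k; apply: pentagon_tri_free.
    - by move=> i; apply: spT.
    - by move=> i j; apply: X_avoids.
  move=> c; rewrite !inE => /or3P[ca|cb|cU].
  - by apply: used; rewrite !inE ca.
  - by apply: used; rewrite !inE cb orbT.
  - apply: subst_gfree; first by move=> i j _; rewrite c0_out // mem_cat cU orbT.
    by move=> i; apply: (coloured_free (cX i)).
Qed.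

(** The pattern is a single edge of colour [a]: it has no triangle, and both parts avoid [a]. *)
Lemma colourable_double U a n :
  a \notin U -> colourable [::] U n -> colourable [::] (a :: U) n.*2.
Proof.
move=> aU [X [<- cX]]; pose c0 (i j : bool) := a.
exists (subst c0 (fun=> X)); split.
  by rewrite card_subst sum_nat_const card_bool mul2n.
split=> //.
- by apply: subst_csym => // _; case: cX.
- apply: subst_gallai => // [i j k _||]; try by case: cX.
  by rewrite /= !inE eqxx.
- move=> [i u] [j v]; have [e|nij] := eqVneq i j.
    case: j / e v => v nuv; rewrite subst_colE inE (coloured_colour cX) ?orbT //.
    by rewrite -(inj_eq (@Tagged_inj _ c0 (fun=> X) i)).
  by move=> _; rewrite subst_col_neq //= inE eqxx.
- have av : avoids X a by exact: (coloured_avoids cX).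
  move=> c; rewrite inE => /predU1P[->|cU].
    apply: subst_gfree_used pathH => //; first exact: ltnW.
    - by case=> [] [] [].
    - by move=> _; apply: avoids_sparse.
    - by left.
  apply: subst_gfree => [i j _|_]; first by apply: contraNneq aU; rewrite /c0 => ->.
  exact: (coloured_free cX).
Qed.

(** Each pair of colours of [U] joins five copies in a pentagon. Neither [e] nor [e'] occurs between
    parts, so both remain sparse. *)
Lemma colourable_two_sparse s e e' :
  (forall e e' : nat, e != e' -> colourable [:: e; e'] [::] s) ->
  forall j U, size U = j.*2 -> uniq [:: e, e' & U] ->
  colourable [:: e; e'] U (5 ^ j * s).
Proof.
move=> leaf; elim=> [|j IHj] [|a [|b U]] //=.
  by rewrite inE andbT mul1n => _ /leaf.
case=> sU; rewrite !inE !negb_or -!andbA.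
case/and5P=> nee nea neb eU /and5P[nea' neb' eU' nab /and3P[aU bU uU]].
have IH : colourable [:: e; e'] U (5 ^ j * s).
  by apply: IHj => //=; rewrite inE negb_or nee eU eU'.
rewrite (_ : 5 ^ j.+1 * s = (5 ^ j * s).*2 + (5 ^ j * s).*2 + 5 ^ j * s); last first.
  by rewrite expnS -!addnn; lia.
apply: colourable_pentagon => //.
- rewrite /= !inE !negb_or nab nee eU eU' aU bU uU.
  by rewrite [a == e]eq_sym [a == e']eq_sym [b == e]eq_sym [b == e']eq_sym nea nea' neb neb'.
- apply: colourable_extra => //; rewrite /= !inE !negb_or aU.
  by rewrite [a == e]eq_sym [a == e']eq_sym nea nea'.
- apply: colourable_extra => //; rewrite /= !inE !negb_or bU.
  by rewrite [b == e]eq_sym [b == e']eq_sym neb neb'.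
Qed.

(** At each pentagon four parts gain a second sparse colour and hold leaves of size [s] only; the
    fifth recurses, which leaves one leaf of size [h]. *)
Lemma colourable_one_sparse s h e :
  (forall e e' : nat, e != e' -> colourable [:: e; e'] [::] s) ->
  (forall e : nat, colourable [:: e] [::] h) ->
  forall j U, size U = j.*2 -> uniq (e :: U) ->
  colourable [:: e] U ((5 ^ j).-1 * s + h).
Proof.
move=> leaf2 leaf1; elim=> [|j IHj] [|a [|b U]] //= [sU].
rewrite !inE !negb_or -!andbA => /and5P[nea neb eU nab /and3P[aU bU uU]].
have two c : c != e -> c \notin U -> colourable [:: c; e] U (5 ^ j * s).
  move=> ce cU; apply: colourable_two_sparse => //=.
  by rewrite inE negb_or ce cU eU.
rewrite expnS (_ : _ + h = (5 ^ j * s).*2 + (5 ^ j * s).*2 + ((5 ^ j).-1 * s + h)).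
  apply: colourable_pentagon.
  - by rewrite /= !inE !negb_or nab eU aU bU uU [a == e]eq_sym [b == e]eq_sym nea neb.
  - by apply: two; rewrite 1?eq_sym.
  - by apply: two; rewrite 1?eq_sym.
  - by apply: IHj => //=; rewrite eU.
have [p ->] : exists p, 5 ^ j = p.+1 by exists (5 ^ j).-1; rewrite prednK ?expn_gt0.
have -> : (5 * p.+1).-1 = 5 * p + 4 by lia.
by rewrite -!addnn; lia.
Qed.

(** The sizes of the F_j: the increments 4((5^i - 1)s + h) for i = 1, ..., j are summed, and 4js is
    moved to the left to avoid truncated subtraction. *)
Lemma colourable_no_sparse s h r :
  (forall e e' : nat, e != e' -> colourable [:: e; e'] [::] s) ->
  (forall e : nat, colourable [:: e] [::] h) ->
  (forall a b : nat, a != b -> colourable [::] [:: a; b] r) ->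
  forall j U, size U = j.+1.*2 -> uniq U ->
  exists2 n, n + 4 * j * s = r + 5 * (5 ^ j).-1 * s + 4 * j * h &
    colourable [::] U n.
Proof.
move=> leaf2 leaf1 base; elim=> [|j IHj] [|a [|b U]] //=.
  case: U => // _; rewrite inE andbT => nab.
  by exists r; [lia | exact: base].
case=> sU; rewrite !inE !negb_or -!andbA => /and4P[nab aU bU uU].
have [n En cn] := IHj U sU uU.
have one c : c \notin U -> colourable [:: c] U ((5 ^ j.+1).-1 * s + h).
  by move=> cU; apply: colourable_one_sparse => //=; rewrite cU.
exists (((5 ^ j.+1).-1 * s + h).*2 + ((5 ^ j.+1).-1 * s + h).*2 + n); last first.
  apply: colourable_pentagon => //; try exact: one.
  by rewrite /= !inE !negb_or nab aU bU uU.
move: En; rewrite expnS.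
have [p ->] : exists p, 5 ^ j = p.+1 by exists (5 ^ j).-1; rewrite prednK ?expn_gt0.
have -> : (5 * p.+1).-1 = 5 * p + 4 by lia.
by rewrite -!addnn; lia.
Qed.

(** * Leaf colourings *)

Lemma gallai_two_colours (X : cgraph) a b :
  (forall x y : X, colour x y = a \/ colour x y = b) -> cgallai X.
Proof.
move=> ab x y z _; case: (ab x y) => ->; case: (ab y z) => ->;
  by case: (ab x z) => ->; rewrite /= !inE !eqxx ?orbT ?andbF.
Qed.

Lemma sparse_small (X : cgraph) c : #|X| < m ->
  (forall x : X, #|[set y | edge c x y]| <= m./2.-1) -> sparse m X c.
Proof.
move=> ltXm dg; split=> // q uq _; apply: leq_ltn_trans ltXm.
by rewrite -(card_uniqP uq) max_card.
Qed.

Lemma colourable_mono_sparse e : colourable [:: e] [::] m./2.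
Proof.
exists (@CGraph 'I_(m./2) (fun _ _ => e)); split; first exact: card_ord.
split=> // [x y z _ /=|x y _|c]; first by rewrite !inE eqxx.
  by rewrite mem_head.
rewrite inE => /eqP->; apply: sparse_small => [|x].
  by rewrite card_ord; move: m_gt1; clear; lia.
rewrite -[X in _ <= X.-1](card_ord m./2) -(cardsC1 x).
apply/subset_leq_card/subsetP=> y.
by rewrite !inE /edge /= eqxx andbT eq_sym.
Qed.

(** The cone has at least m + 1 vertices, one for the centre and m on the path. *)
Lemma colourable_mono_free a : colourable [::] [:: a] m.
Proof.
exists (@CGraph 'I_m (fun _ _ => a)); split; first exact: card_ord.
split=> // [x y z _ /=|x y _|c _]; first by rewrite !inE eqxx.
  by rewrite mem_head.
move=> f f_inj _; case: pathH => q [uq sq _].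
have : size [seq f u | u <- None :: [seq Some u | u <- q]] <= #|'I_m|.
  rewrite -(card_uniqP _) ?max_card // map_inj_uniq //= map_inj_uniq; last first.
    by move=> u v [].
  by rewrite uq andbT; apply/mapP=> -[].
by rewrite !size_map /= size_map sq card_ord ltnn.
Qed.

(** Two cliques on m/2 - 1 vertices in colour [e], joined completely in [e'], have degrees m/2 - 2
    and m/2 - 1. *)
Lemma colourable_bipartite_leaf e e' : e != e' ->
  colourable [:: e; e'] [::] (m - 2).
Proof.
move=> nee.
pose X := @CGraph (bool * 'I_(m./2.-1))%type (fun x y => if x.1 == y.1 then e else e').
have cX : #|X| = m - 2.
  by rewrite card_prod card_bool card_ord; move: m_even; clear; lia.
exists X; split=> //; split=> // [x y|x y z|x y _|c ce].
- by rewrite /= eq_sym.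
- by apply: (@gallai_two_colours _ e e') => {x y z}x y /=; case: ifP; [left|right].
- by rewrite /= !inE; case: ifP; rewrite eqxx ?orbT.
apply: sparse_small => [|x]; first by rewrite cX; move: m_gt1; clear; lia.
(* The side containing all neighbours of [x] in colour [c]. *)
pose b := if c == e then x.1 else ~~ x.1.
rewrite -[X in _ <= X]card_ord -cardsT.
apply: leq_trans (leq_imset_card (pair b) _).
apply/subset_leq_card/subsetP=> -[y1 y2]; rewrite inE => /andP[_ /= /eqP ec].
apply/imsetP; exists y2; rewrite // /b -ec {ce b c ec}.
by case: x => [[] ?] /=; case: y1; rewrite ?eqxx // eq_sym (negbTE nee).
Qed.

(** The listed value is j - i modulo n, which determines j. *)
Lemma card_cyclic_shift n (i : 'I_n) (A : {set 'I_n}) (L : seq nat) :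
  {in A, forall j : 'I_n, (if i <= j then j - i else n + j - i) \in L} ->
  #|A| <= size L.
Proof.
move=> AL; pose g (j : 'I_n) := if i <= j then j - i else n + j - i.
have g_inj : injective g.
  move=> j j'; rewrite /g => e; apply: val_inj => /=; move: e.
  have := ltn_ord i; have := ltn_ord j; have := ltn_ord j'.
  by case: ifP; case: ifP; lia.
rewrite cardE -(size_map g); apply: uniq_leq_size.
  by rewrite map_inj_uniq ?enum_uniq.
by move=> x /mapP[j]; rewrite mem_enum => /AL jL ->.
Qed.

(* With m = 4q + 2, the circulant graph on m - 1 = 4q + 1 vertices joining those
   at cyclic distance at most q is 2q-regular, and so is its complement. *)
Lemma colourable_circulant_leaf e e' : m = 2 %[mod 4] -> e != e' ->
  colourable [:: e; e'] [::] (m - 1).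
Proof.
move=> m2 nee; pose q := m %/ 4.
have Em : m = 4 * q + 2 by rewrite {1}(divn_eq m 4) m2 mulnC.
(* One of the truncated differences vanishes, so d = |i - j|; on 4q + 1 points, d > 3q says that the
   way round the other side has length at most q. *)
pose near (i j : nat) := let d := i - j + (j - i) in (d <= q) || (3 * q < d).
pose X := @CGraph 'I_(m - 1) (fun i j => if near i j then e else e').
have cX : #|X| = m - 1 by rewrite card_ord.
exists X; split=> //; split=> // [x y|x y z|x y _|c ce].
- by rewrite /= /near addnC.
- by apply: (@gallai_two_colours _ e e') => {x y z}x y /=; case: ifP; [left|right].
- by rewrite /= !inE; case: ifP; rewrite eqxx ?orbT.
apply: sparse_small => [|x]; first by rewrite cX; move: m_gt1; clear; lia.
have -> : m./2.-1 = 2 * q by rewrite Em; clear; lia.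
pose L := if c == e then iota 1 q ++ iota (3 * q + 1) q else iota q.+1 (2 * q).
have -> : 2 * q = size L by rewrite /L; case: ifP; rewrite ?size_cat !size_iota //; lia.
apply: (card_cyclic_shift (i := x)) => y; rewrite inE => /andP[nxy /= /eqP ec].
have {}nxy : (x : nat) != y by [].
rewrite /L -ec; have := ltn_ord x; have := ltn_ord y; move: nxy.
have {}Em : m - 1 = 4 * q + 1 by rewrite Em; lia.
case: (boolP (near x y)); rewrite ?eqxx 1?[e' == e]eq_sym ?(negbTE nee) /near
  ?mem_cat !mem_iota; clearbody q; by case: ifP; lia.
Qed.
End Colourings.

(** * Transfer to [R2] and [GR] *)

Lemma has_monoP (k : nat) (V : finType) (tau : coloring k V) (G : sgraph) :
  reflect (exists (i : 'I_k) (f : G -> V), injective f /\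
             forall x y, adj x y -> tau [set f x; f y] = i)
          (has_mono tau G).
Proof.
apply: (iffP existsP) => -[i].
  case/existsP=> f /andP[/injectiveP f_inj /forallP fi]; exists i, f.
  split=> // x y xy; have /forallP/(_ y) := fi x.
  by rewrite xy => /eqP.
case=> f [f_inj fi]; exists i; apply/existsP; exists (finfun f); apply/andP.
split; first by apply/injectiveP=> x y; rewrite !ffunE => /f_inj.
apply/forallP=> x; apply/forallP=> y; apply/implyP=> xy.
by rewrite !ffunE fi.
Qed.

Lemma set2_eq (T : finType) (x y u v : T) :
  [set x; y] = [set u; v] -> (x = u /\ y = v) \/ (x = v /\ y = u).
Proof.
move=> e; have := set21 x y; have := set22 x y; rewrite e !inE.
have := set21 u v; have := set22 u v; rewrite -e !inE.
do 4!case/orP=> /eqP ?; subst; by [left | right].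
Qed.

Section ColouringNumbers.
Variables (m : nat) (H : sgraph).
Hypotheses (m_gt1 : 1 < m) (pathH : has_path m H).

Lemma colourable_R2 a b : a != b -> colourable m H [::] [:: a; b] (R2 (cone H)).-1.
Proof.
move=> nab; rewrite /R2; case: ex_minnP => r /andP[r_gt0 _] r_min.
have [tau /has_monoP ntau] : exists tau : coloring 2 'I_r.-1, ~~ has_mono tau (cone H).
  (* [ramsey_forces] requires a positive order, so the empty vertex set is treated apart: there the
     centre has no image. *)
  case: (posnP r.-1) => [r0|r1_gt0].
    exists [ffun=> ord0]; apply/has_monoP=> -[_ [f _]].
    by have := ltn_ord (f None); rewrite {2}r0.
  apply/existsP; rewrite -negb_forall; apply/negP=> all_mono.
  have /r_min : ramsey_forces 2 (cone H) r.-1 by rewrite /ramsey_forces r1_gt0.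
  by rewrite leqNgt ltn_predL r_gt0.
exists (@CGraph 'I_r.-1 (fun x y => if tau [set x; y] == ord0 then a else b)).
split; first exact: card_ord.
split=> // [x y||x y _|c cab f f_inj fc].
- by rewrite /= setUC.
- by apply: (@gallai_two_colours _ a b) => x y /=; case: ifP; [left|right].
- by rewrite /= !inE; case: ifP; rewrite eqxx ?orbT.
apply: ntau; exists (if c == a then ord0 else ord_max), f; split=> // x y /fc.
case/andP=> _ /= /eqP <-; case: (tau _ =P ord0) => [->|/eqP]; first by rewrite eqxx.
rewrite eq_sym [b == a]eq_sym (negbTE nab) => tau0; apply/val_inj; move: tau0.
by case: (tau _) => [[|[|]]].
Qed.

Lemma colourable_GR k U n : 0 < k -> {in U, forall c, c < k} ->
  colourable m H [::] U n -> n < GR k (cone H).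
Proof.
case: k => // k _ Uk [X [<- cX]]; rewrite /GR.
case: ex_minnP => N /andP[_ /forallP force] _; rewrite ltnNge; apply/negP=> leN.
pose g (x : 'I_N) : X := enum_val (widen_ord leN x).
have g_inj : injective g by move=> x y /enum_val_inj /(congr1 val)/= /val_inj.
(* The picked pair orders the two ends of an edge; by symmetry of [colour] the choice does not
   matter. *)
pose tau : coloring k.+1 'I_N := [ffun A : {set 'I_N} =>
  if [pick p : 'I_N * 'I_N | A == [set p.1; p.2]] is Some p
  then inord (colour (g p.1) (g p.2)) else ord0].
have tauE x y : tau [set x; y] = inord (colour (g x) (g y)).
  rewrite ffunE; case: pickP => [[u v] /= /eqP|/(_ (x, y))]; last by rewrite eqxx.
  by case/set2_eq=> -[-> ->] //; rewrite (coloured_sym cX).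
have tau_gallai : gallai tau.
  apply/forallP=> x; apply/forallP=> y; apply/forallP=> z; apply/negP.
  rewrite /rainbow_triangle !tauE => /andP[xyz uc].
  have /negP[] : ~~ uniq [:: colour (g x) (g y); colour (g y) (g z); colour (g x) (g z)].
    by apply: (coloured_gallai cX); rewrite -(map_inj_uniq g_inj) in xyz.
  (* Applying [inord] cannot make equal colours distinct, so it creates no rainbow triangle. *)
  exact: (@map_uniq _ _ (@inord k)).
have /implyP/(_ tau_gallai)/has_monoP[i [f [f_inj fi]]] := force tau.
have edge_i x y : adj x y -> edge i (g (f x)) (g (f y)).
  move=> xy; have ne : g (f x) != g (f y).
    by rewrite (inj_eq g_inj) (inj_eq f_inj); apply: contraTneq xy => ->; rewrite adj_irr.
  rewrite /edge ne /= -(fi _ _ xy) tauE inordK //.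
  by apply: Uk; have := coloured_colour cX ne.
have iU : (i : nat) \in U.
  case: pathH => [[|u q] [_ sq _]]; first by move: m_gt1; rewrite -sq.
  have /andP[ne /eqP <-] := edge_i None (Some u) isT.
  exact: (coloured_colour cX ne).
apply: (coloured_free cX iU (f := g \o f)) => [x y /g_inj/f_inj //|x y].
exact: edge_i.
Qed.
End ColouringNumbers.

(** * Lower bounds in terms of the leaf size *)

Local Open Scope ring_scope.

Lemma R2_gt0 G : (0 < R2 G)%N.
Proof. by rewrite /R2; case: ex_minnP => r /andP[]. Qed.

Section LowerBounds.
Variables (m : nat) (H : sgraph).
Hypotheses (m_gt1 : (1 < m)%N) (m_even : ~~ odd m) (pathH : has_path m H).

Section Leaf.
Variable s : nat.
Hypothesis leaf : forall e e' : nat, e != e' -> colourable m H [:: e; e'] [::] s.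

(** The successor [n.+1] absorbs the vertex missing from the base colouring on R_2 - 1 vertices. *)
Lemma colourable_iota j :
  exists2 n, n.+1%:Z = (R2 (cone H))%:Z + 5 * s%:Z * (5 ^+ j - 1)
                         - 4 * (s%:Z - m./2%:Z) * j%:Z &
    colourable m H [::] (iota 0 j.+1.*2) n.
Proof.
have [n En cn] := colourable_no_sparse m_gt1 m_even pathH leaf
  (colourable_mono_sparse H m_gt1) (@colourable_R2 m H)
  (size_iota 0 j.+1.*2) (iota_uniq 0 j.+1.*2).
exists n => //.
have -> : (5 : int) ^+ j = (5 ^ j)%N%:Z by rewrite -natrX natz.
move: En; have := R2_gt0 (cone H).
have [p ->] : exists p, (5 ^ j = p.+1)%N.
  by exists (5 ^ j).-1; rewrite prednK ?expn_gt0.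
by move=> /=; lia.
Qed.

Lemma GR_even_ge j :
  (R2 (cone H))%:Z + 5 * s%:Z * (5 ^+ j - 1) - 4 * (s%:Z - m./2%:Z) * j%:Z
    <= (GR j.+1.*2 (cone H))%:Z.
Proof.
have [n <- cn] := colourable_iota j.
by apply: (colourable_GR m_gt1 pathH _ _ cn) => // c; rewrite mem_iota.
Qed.

Lemma GR_odd_ge j :
  2 * ((R2 (cone H))%:Z + 5 * s%:Z * (5 ^+ j - 1)
         - 4 * (s%:Z - m./2%:Z) * j%:Z) - 1
    <= (GR j.+1.*2.+1 (cone H))%:Z.
Proof.
have [n <- cn] := colourable_iota j.
suff: (n.*2 < GR j.+1.*2.+1 (cone H))%N by lia.
apply: (colourable_GR m_gt1 pathH (U := j.+1.*2 :: iota 0 j.+1.*2)) => //.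
  move=> c; rewrite inE mem_iota /= => /predU1P[->|/ltnW//].
  exact: ltnSn.
by apply: colourable_double => //; rewrite mem_iota /= ltnn.
Qed.
End Leaf.

Lemma GR3_ge : (5 * m < GR 3 (cone H))%N.
Proof.
apply: (colourable_GR m_gt1 pathH (U := [:: 0; 1; 2])%N) => //.
  by move=> c; rewrite !inE => /or3P[] /eqP->.
have c2 := colourable_mono_free pathH 2.
rewrite (_ : 5 * m = m.*2 + m.*2 + m)%N; last by rewrite -!addnn; lia.
by apply: colourable_pentagon => //; apply: colourable_extra.
Qed.
End LowerBounds.

(** * Kipas, wheels and the stated cases *)

Lemma has_path_succ m (H : sgraph) (h : 'I_m -> H) : injective h ->
  (forall i j : 'I_m, i.+1 = j -> adj (h i) (h j)) -> has_path m H.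
Proof.
move=> h_inj hS; exists [seq h i | i <- enum 'I_m]; split.
- by rewrite map_inj_uniq ?enum_uniq.
- by rewrite size_map size_enum_ord.
rewrite sorted_map; apply: (sub_sorted (e := relpre val [rel i j | i.+1 == j])).
  by move=> i j /= /eqP/hS.
rewrite -sorted_map val_enum_ord; case: m {h h_inj hS} => //= m.
by elim: m 0%N => //= m IHm i; rewrite eqxx IHm.
Qed.

Lemma has_path_path m : has_path m (path_graph m).
Proof.
by apply: (@has_path_succ _ (path_graph m) id) => // i j e; rewrite /= /path_adj e eqxx.
Qed.

Lemma has_path_cycle m : has_path m (cycle_graph m).
Proof.
apply: (@has_path_succ _ (cycle_graph m) id) => // i j e.
rewrite /= /cycle_adj -!val_eqE /= e modn_small // eqxx andbT.
by rewrite -e neq_ltn ltnSn.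
Qed.

Theorem theorem3 (k m : nat) (G : sgraph)
    (hk : (2 <= k)%N) (hm : (6 <= m)%N) (hm_even : ~~ odd m)
    (hG : G = kipas m \/ G = wheel m) :
  [/\ k = 3%N ->
        Num.max (2 * (R2 G)%:Z - 1) (5 * m%:Z + 1) <= (GR k G)%:Z,
      ~~ odd k -> m = 0 %[mod 4] ->
        (R2 G)%:Z + 5 * (m%:Z - 2) * (5 ^+ ((k - 2) %/ 2)%N - 1)
          - (m%:Z - 4) * (k%:Z - 2) <= (GR k G)%:Z,
      ~~ odd k -> m = 2 %[mod 4] ->
        (R2 G)%:Z + 5 * (m%:Z - 1) * (5 ^+ ((k - 2) %/ 2)%N - 1)
          - (m%:Z - 2) * (k%:Z - 2) <= (GR k G)%:Z,
      (5 <= k)%N -> odd k -> m = 0 %[mod 4] ->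
        2 * ((R2 G)%:Z + 5 * (m%:Z - 2) * (5 ^+ ((k - 3) %/ 2)%N - 1)
               - (m%:Z - 4) * (k%:Z - 3)) - 1 <= (GR k G)%:Z
    & (5 <= k)%N -> odd k -> m = 2 %[mod 4] ->
        2 * ((R2 G)%:Z + 5 * (m%:Z - 1) * (5 ^+ ((k - 3) %/ 2)%N - 1)
               - (m%:Z - 2) * (k%:Z - 3)) - 1 <= (GR k G)%:Z].
Proof.
have m_gt1 : (1 < m)%N by lia.
have [H pathH ->] : exists2 H, has_path m H & G = cone H.
  by case: hG => ->; [exists (path_graph m) | exists (cycle_graph m)] => //;
    [exact: has_path_path | exact: has_path_cycle].
have leaf0 := colourable_bipartite_leaf H m_gt1 hm_even.
have leaf2 : m = 2 %[mod 4] -> forall e e' : nat, e != e' ->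
    colourable m H [:: e; e'] [::] (m - 1).
  by move=> m2 e e'; apply: colourable_circulant_leaf.
(* The coefficient 4(s - m/2) equals 2(m - 4) for s = m - 2 and 2(m - 2) for s = m - 1; the factor
   2j is k - 2 or k - 3. *)
have Em : m%:Z = 2 * m./2%:Z by lia.
have Em2 : (m - 2)%N%:Z = 2 * m./2%:Z - 2 by lia.
have Em1 : (m - 1)%N%:Z = 2 * m./2%:Z - 1 by lia.
have Ek j : j.+1.*2%:Z = 2 * j%:Z + 2 by lia.
have Ek' j : j.+1.*2.+1%:Z = 2 * j%:Z + 3 by lia.
have even_k : ~~ odd k -> exists2 j, k = j.+1.*2 & ((k - 2) %/ 2 = j)%N.
  by move=> ok; exists (k./2.-1); lia.
have odd_k : odd k -> exists2 j, k = j.+1.*2.+1 & ((k - 3) %/ 2 = j)%N.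
  by move=> ok; exists (k./2.-1); lia.
split.
- move=> k3; rewrite ge_max; apply/andP; split; last first.
    by have := GR3_ge m_gt1 hm_even pathH; rewrite k3; lia.
  (* At j = 0 the terms containing the leaf size vanish, so the leaf that exists for every even m
     serves both residues. *)
  have := GR_odd_ge m_gt1 hm_even pathH leaf0 0.
  by rewrite expr0 subrr !mulr0 addr0 subr0 k3.
- case/even_k=> j -> -> _; apply: le_trans (GR_even_ge m_gt1 hm_even pathH leaf0 j).
  by rewrite Em Em2 Ek; lia.
- case/even_k=> j -> -> /leaf2 leaf.
  by apply: le_trans (GR_even_ge m_gt1 hm_even pathH leaf j); rewrite Em Em1 Ek; lia.
- move=> _ /odd_k[] // j -> -> _.
  by apply: le_trans (GR_odd_ge m_gt1 hm_even pathH leaf0 j); rewrite Em Em2 Ek'; lia.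
- move=> _ /odd_k[] // j -> -> /leaf2 leaf.
  by apply: le_trans (GR_odd_ge m_gt1 hm_even pathH leaf j); rewrite Em Em1 Ek'; lia.
Qed.
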